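(* Let $G$ be a group containing a free abelian subgroup $H$ with $|H|=|G|$, and let $\mathcal F$ be a sub-invariant ideal of subsets of $G$ such that $\tau(\mathcal F)\cap\mathcal P_H\not\subset\mathcal F$. Then $\tau^*(\mathcal F)\ne\tau^\alpha(\mathcal F)\ne\tau^{<\alpha}(\mathcal F)$ for all ordinals $\alpha<|G|^+$.
   Context: An ideal is a family of subsets closed under subsets and finite unions. For an isomorphism $h:H_1\to K_1$ between subgroups of $G$, $\mathcal F$ is $h$-invariant if for every $A\subset H_1$: $A\in\mathcal F$ iff $h(A)\in\mathcal F$. A left-invariant family ($xF\in\mathcal F$ for $F\in\mathcal F$, $x\in G$) is sub-invariant if it is $h$-invariant for every isomorphism $h:H_1\to K_1$ between subgroups $K_1\subset H_1$ of $G$. $\tau(\mathcal F)=\{A\subset G: xA\cap yA\in\mathcal F$ for all distinct $x,y\in G\}$, $\tau^0(\mathcal F)=\mathcal F$, $\tau^{<\alpha}(\mathcal F)=\bigcup_{\beta<\alpha}\tau^\beta(\mathcal F)$, $\tau^\alpha(\mathcal F)=\tau(\tau^{<\alpha}(\mathcal F))$ for $\alpha>0$; $\tau^*(\mathcal F)$ is the smallest family $\tilde{\mathcal F}\supset\mathcal F$ with $\tau(\tilde{\mathcal F})=\tilde{\mathcal F}$. $\mathcal P_H$ is the family of subsets of $H$.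
   Formalization: The group G is assumed infinite; this excludes only the trivial group, where the claim fails: for G = H = {e} and F = {∅}, τ^1(F) is the family of all subsets of G, which equals τ^*(F), although 1 < |G|^+ = 2. *)

(* Defs.v *)
From Stdlib Require Import ZArith List.
Set Implicit Arguments.

Section Defs.
Variable G : Type.
Variable mul : G -> G -> G.
Variable one : G.
Variable inv : G -> G.

Record is_group : Prop := {
  mulA : forall x y z, mul x (mul y z) = mul (mul x y) z;
  mul1g : forall x, mul one x = x;
  mulg1 : forall x, mul x one = x;
  mulVg : forall x, mul (inv x) x = one;
  mulgV : forall x, mul x (inv x) = one }.

Definition subset (A B : G -> Prop) : Prop := forall g, A g -> B g.
Definition inter (A B : G -> Prop) : G -> Prop := fun g => A g /\ B g.
Definition union (A B : G -> Prop) : G -> Prop := fun g => A g \/ B g.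
Definition lmul (x : G) (A : G -> Prop) : G -> Prop :=
  fun g => exists a, A a /\ g = mul x a.
Definition image (h : G -> G) (A : G -> Prop) : G -> Prop :=
  fun g => exists a, A a /\ g = h a.

Definition fam_eq (X Y : (G -> Prop) -> Prop) : Prop := forall A, X A <-> Y A.

Definition is_subgroup (H : G -> Prop) : Prop :=
  H one /\ (forall x y, H x -> H y -> H (mul x y)) /\ (forall x, H x -> H (inv x)).

Fixpoint npow (g : G) (n : nat) : G :=
  match n with O => one | S n => mul g (npow g n) end.
Definition zpow (g : G) (z : Z) : G :=
  match z with
  | Z0 => one
  | Zpos p => npow g (Pos.to_nat p)
  | Zneg p => inv (npow g (Pos.to_nat p))
  end.
Definition zcomb (l : list (G * Z)) : G :=
  fold_right (fun p acc => mul (zpow (fst p) (snd p)) acc) one l.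

Definition free_abelian_subgroup (H : G -> Prop) : Prop :=
  is_subgroup H /\
  (forall x y, H x -> H y -> mul x y = mul y x) /\
  exists B : G -> Prop,
    (forall b, B b -> H b) /\
    (forall h, H h -> exists l : list (G * Z),
        Forall (fun p => B (fst p)) l /\ h = zcomb l) /\
    (forall l : list (G * Z),
        Forall (fun p => B (fst p) /\ snd p <> 0%Z) l ->
        NoDup (map (@fst G Z) l) -> zcomb l = one -> l = nil).

Definition is_ideal (F : (G -> Prop) -> Prop) : Prop :=
  (forall A B, subset A B -> F B -> F A) /\
  (forall A B, F A -> F B -> F (union A B)).

Definition left_invariant (F : (G -> Prop) -> Prop) : Prop :=
  forall A x, F A -> F (lmul x A).

Definition subgroup_iso (H1 K1 : G -> Prop) (h : G -> G) : Prop :=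
  is_subgroup H1 /\ is_subgroup K1 /\
  (forall x, H1 x -> K1 (h x)) /\
  (forall x y, H1 x -> H1 y -> h (mul x y) = mul (h x) (h y)) /\
  (forall x y, H1 x -> H1 y -> h x = h y -> x = y) /\
  (forall z, K1 z -> exists x, H1 x /\ h x = z).

Definition h_invariant (F : (G -> Prop) -> Prop) (H1 : G -> Prop) (h : G -> G) : Prop :=
  forall A, subset A H1 -> (F A <-> F (image h A)).

Definition sub_invariant (F : (G -> Prop) -> Prop) : Prop :=
  left_invariant F /\
  forall (H1 K1 : G -> Prop) (h : G -> G),
    subgroup_iso H1 K1 h -> subset K1 H1 -> h_invariant F H1 h.

Definition tau (X : (G -> Prop) -> Prop) : (G -> Prop) -> Prop :=
  fun A => forall x y, x <> y -> X (inter (lmul x A) (lmul y A)).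

Definition tau_star (F : (G -> Prop) -> Prop) : (G -> Prop) -> Prop :=
  fun A => forall X : (G -> Prop) -> Prop,
    (forall B, F B -> X B) -> fam_eq (tau X) X -> X A.

(** Ordinals are encoded by elements t of a well-ordered type (W, lt):
    t stands for the order type of the initial segment {s | lt s t}. *)
Record well_order (W : Type) (lt : W -> W -> Prop) : Prop := {
  wo_trans : forall a b c, lt a b -> lt b c -> lt a c;
  wo_irrefl : forall a, ~ lt a a;
  wo_total : forall a b, lt a b \/ a = b \/ lt b a;
  wo_wf : well_founded lt }.

(** transfinite iteration: tau^t(F) = F if t is the least element (ordinal 0),
    tau^t(F) = tau(tau^{<t}(F)) otherwise, where tau^{<t} = union_{s<t} tau^s.
    (The tau-clause is inlined to keep the inductive strictly positive.) *)
Inductive tau_iter (F : (G -> Prop) -> Prop) (W : Type) (lt : W -> W -> Prop)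
  : W -> (G -> Prop) -> Prop :=
| ti_zero : forall t A, (forall s, ~ lt s t) -> F A -> tau_iter F lt t A
| ti_succ : forall t A, (exists s, lt s t) ->
    (forall x y, x <> y ->
       exists s, lt s t /\ tau_iter F lt s (inter (lmul x A) (lmul y A))) ->
    tau_iter F lt t A.

Definition tau_below (F : (G -> Prop) -> Prop) (W : Type) (lt : W -> W -> Prop)
  (t : W) : (G -> Prop) -> Prop :=
  fun A => exists s, lt s t /\ tau_iter F lt s A.

End Defs.

Definition equipotent (X Y : Type) : Prop :=
  exists f : X -> Y, (forall a b, f a = f b -> a = b) /\ (forall y, exists x, f x = y).

Definition card_le (X Y : Type) : Prop :=
  exists f : X -> Y, forall a b, f a = f b -> a = b.

(* Main.v *)
From mathcomp Require classical_sets.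
Require Import Defs.
From Stdlib Require Import ZArith List Lia Cantor Classical ClassicalEpsilon.
Set Implicit Arguments.
Set Bullet Behavior "Strict Subproofs".

(** Call a set thin if it is in the least family that contains F and every A with A ∩ gA in the
    family for all 1 <> g in H; thin subsets of H lie in every fixed point of tau above F. Since
    H is torsion-free, thin sets form an ideal: if A meets its nontrivial shifts in sets that can
    be added to any thin set without losing thinness, then intersecting a finite union of
    translates of A with a shift leaves, up to such sets, strictly fewer translates.

    Freeness and |W| <= |H| give injective endomorphisms phi_s of H, s in W, such that for each
    g <> 1 the ranges of phi_i and g phi_j are disjoint unless i or j lies in a finite set depending
    on g. Hence the union U of phi_s(A_s) is thin whenever all A_s are. Choosing inductively
    A_s thin outside tau^s(F) for s < t, the set A_t formed by U, a shift x U and a set of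
    tau(F) outside F is thin; its intersection with its shift by x contains x phi_s(A_s) for all
    s < t, so A_t is not in tau^t(F). A thin set outside tau^t(F) refutes both equalities. *)

(** * Cardinal arithmetic *)

Lemma zorn_sets (T : Type) (P : (T -> Prop) -> Prop) :
  (forall C : (T -> Prop) -> Prop, (forall A, C A -> P A) ->
     (forall A B, C A -> C B -> (forall x, A x -> B x) \/ (forall x, B x -> A x)) ->
     P (fun x => exists A, C A /\ A x)) ->
  exists A, P A /\ forall B, P B -> (forall x, A x -> B x) -> forall x, B x -> A x.
Proof.
  intros chain.
  destruct (@classical_sets.Zorn_bigcup T P) as [A [PA maxA]].
  - intros C CP Ctot.
    replace (classical_sets.bigcup C (fun X => X)) with (fun x => exists A, C A /\ A x).
    { apply chain; [exact CP | exact Ctot]. }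
    apply boolp.funext; intros x; apply boolp.propext; split.
    + intros [A [CA Ax]]; exists A; assumption.
    + intros [A CA Ax]; exists A; split; assumption.
  - exists A; split; [exact PA|].
    intros B PB AB x Bx; apply NNPP; intros nAx.
    apply (maxA B); [|exact PB].
    split; [exact AB|]. intros BA; apply nAx, BA, Bx.
Qed.

Lemma card_le_trans (X Y Z : Type) : card_le X Y -> card_le Y Z -> card_le X Z.
Proof.
  intros [f finj] [g ginj]; exists (fun x => g (f x)); intros a b E; auto.
Qed.

Lemma card_le_total (X Y : Type) : card_le X Y \/ card_le Y X.
Proof.
  pose (pinj := fun R : X * Y -> Prop =>
    (forall x y y', R (x, y) -> R (x, y') -> y = y') /\
    (forall x x' y, R (x, y) -> R (x', y) -> x = x')).
  destruct (@zorn_sets (X * Y) pinj) as [R [[Rfun Rinj] Rmax]].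
  { intros C CP Ctot.
    assert (join : forall p q, (exists A, C A /\ A p) -> (exists A, C A /\ A q) ->
              exists A, pinj A /\ A p /\ A q).
    { intros p q [A [CA Ap]] [B [CB Bq]].
      destruct (Ctot A B CA CB) as [S|S]; [exists B|exists A]; auto. }
    split; intros a b c H1 H2; destruct (join _ _ H1 H2) as (A & [Af Ai] & ? & ?); eauto. }
  destruct (classic (forall x, exists y, R (x, y))) as [Rtot|Rtot].
  { left. exists (fun x => proj1_sig (constructive_indefinite_description _ (Rtot x))).
    intros a b E.
    pose proof (proj2_sig (constructive_indefinite_description _ (Rtot a))) as Ha.
    pose proof (proj2_sig (constructive_indefinite_description _ (Rtot b))) as Hb.
    cbv beta in Ha, Hb. rewrite E in Ha. eauto. }
  destruct (classic (forall y, exists x, R (x, y))) as [Rsur|Rsur].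
  { right. exists (fun y => proj1_sig (constructive_indefinite_description _ (Rsur y))).
    intros a b E.
    pose proof (proj2_sig (constructive_indefinite_description _ (Rsur a))) as Ha.
    pose proof (proj2_sig (constructive_indefinite_description _ (Rsur b))) as Hb.
    cbv beta in Ha, Hb. rewrite E in Ha. eauto. }
  exfalso.
  apply not_all_ex_not in Rtot; destruct Rtot as [x0 Hx].
  apply not_all_ex_not in Rsur; destruct Rsur as [y0 Hy].
  apply Hx; exists y0.
  apply (Rmax (fun p => R p \/ p = (x0, y0))); auto.
  split; intros a b c [H1|H1] [H2|H2]; try inversion H1; try inversion H2; subst; eauto;
    solve [exfalso; eauto].
Qed.

(* [S (a, (b, c))] reads "the code of the pair (a, b) is c"; the domain of [S] is a square D * D
   and the codes lie in D. *)
Record pairing_graph (X : Type) (S : X * (X * X) -> Prop) : Prop := {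
  pg_fun : forall a b c c', S (a, (b, c)) -> S (a, (b, c')) -> c = c';
  pg_inj : forall a b a' b' c, S (a, (b, c)) -> S (a', (b', c)) -> a = a' /\ b = b';
  pg_total : forall a b u v, S (a, u) -> S (b, v) -> exists c, S (a, (b, c));
  pg_snd : forall a b c, S (a, (b, c)) -> exists u, S (b, u);
  pg_val : forall a b c, S (a, (b, c)) -> exists u, S (c, u) }.

(** Each clause of [pairing_graph] has at most two points of the graph as premises, so it passes
    from sub-pairings to their union. Chains in Zorn's lemma are treated this way. *)
Lemma pairing_graph_directed (X : Type) (U : X * (X * X) -> Prop) :
  (forall p q, U p -> U q ->
     exists S, pairing_graph S /\ (forall r, S r -> U r) /\ S p /\ S q) ->
  pairing_graph U.
Proof.
  intros dir; split.
  - intros a b c c' H1 H2; destruct (dir _ _ H1 H2) as (S & GS & SU & ? & ?).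
    eapply (pg_fun GS); eauto.
  - intros a b a' b' c H1 H2; destruct (dir _ _ H1 H2) as (S & GS & SU & ? & ?).
    eapply (pg_inj GS); eauto.
  - intros a b u v H1 H2; destruct (dir _ _ H1 H2) as (S & GS & SU & K1 & K2).
    destruct (pg_total GS _ _ _ _ K1 K2) as [c Hc]; eauto.
  - intros a b c H1; destruct (dir _ _ H1 H1) as (S & GS & SU & K1 & _).
    destruct (pg_snd GS _ _ _ K1) as [u Hu]; eauto.
  - intros a b c H1; destruct (dir _ _ H1 H1) as (S & GS & SU & K1 & _).
    destruct (pg_val GS _ _ _ K1) as [u Hu]; eauto.
Qed.

(** * Doubling the domain of a pairing *)

Section PairingDoubling.
Variables (X : Type) (S : X * (X * X) -> Prop) (GS : pairing_graph S).
Let D x := exists u, S (x, u).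
Variables (f : X -> X -> X) (Sf : forall a b, D a -> D b -> S (a, (b, f a b))).
Variables (k : X -> X) (kD : forall a, D a -> ~ D (k a)).
Hypothesis kinj : forall a b, D a -> D b -> k a = k b -> a = b.
Variables (e0 e1 e2 : X) (De0 : D e0) (De1 : D e1) (De2 : D e2).
Hypotheses (e01 : e0 <> e1) (e02 : e0 <> e2) (e12 : e1 <> e2).

(** Passing from D to D ∪ k(D) adds three blocks of pairs. Their codes all go to k(D), and the tags
    [e0], [e1], [e2] record the block. *)
Definition doubled_graph (p : X * (X * X)) : Prop :=
  S p \/ exists a b, D a /\ D b /\
    (p = (a, (k b, k (f e0 (f a b)))) \/ p = (k a, (b, k (f e1 (f a b)))) \/
     p = (k a, (k b, k (f e2 (f a b))))).

Lemma coded_closed a b : D a -> D b -> D (f a b).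
Proof. intros Da Db; exact (pg_val GS _ _ _ (Sf Da Db)). Qed.

Lemma coded_inj a b a' b' :
  D a -> D b -> D a' -> D b' -> f a b = f a' b' -> a = a' /\ b = b'.
Proof.
  intros Da Db Da' Db' E. pose proof (Sf Da Db) as H1. rewrite E in H1.
  exact (pg_inj GS _ _ _ _ _ H1 (Sf Da' Db')).
Qed.

Lemma k_coded_inj e a b e' a' b' :
  D e -> D a -> D b -> D e' -> D a' -> D b' ->
  k (f e (f a b)) = k (f e' (f a' b')) -> e = e' /\ a = a' /\ b = b'.
Proof.
  intros De Da Db De' Da' Db' E.
  apply kinj in E; auto using coded_closed.
  apply coded_inj in E; auto using coded_closed.
  destruct E as [-> E]. apply coded_inj in E; auto.
Qed.

Lemma graph_in_square a b c : S (a, (b, c)) -> D a /\ D b /\ D c.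
Proof.
  intros H1; repeat split.
  - exists (b, c); exact H1.
  - exact (pg_snd GS _ _ _ H1).
  - exact (pg_val GS _ _ _ H1).
Qed.

Lemma doubled_domain x : (exists u, doubled_graph (x, u)) <-> D x \/ exists a, D a /\ x = k a.
Proof.
  split.
  - intros [u [H1|(a & b & Da & Db & [E|[E|E]])]]; [left; exists u; exact H1|..];
      injection E; intros; subst; eauto.
  - intros [Dx|(a & Da & ->)].
    + exists (x, f x x); left; auto.
    + exists (k a, k (f e2 (f a a))); right; exists a, a; auto.
Qed.

Lemma pairing_graph_doubled : pairing_graph doubled_graph.
Proof.
  assert (sep : forall a b, D a -> D b -> k a = b -> False).
  { intros a b Da Db <-; exact (kD Da Db). }
  split.
  - intros a b c c' [H1|(u & v & Du & Dv & K1)] [H2|(u' & v' & Du' & Dv' & K2)].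
    + exact (pg_fun GS _ _ _ _ H1 H2).
    + apply graph_in_square in H1 as (? & ? & ?).
      destruct K2 as [E|[E|E]]; injection E; intros; subst; exfalso; eauto.
    + apply graph_in_square in H2 as (? & ? & ?).
      destruct K1 as [E|[E|E]]; injection E; intros; subst; exfalso; eauto.
    + destruct K1 as [E1|[E1|E1]], K2 as [E2|[E2|E2]];
        injection E1; injection E2; intros; subst;
        repeat match goal with
        | E : k _ = k _ |- _ => apply kinj in E; [subst|assumption|assumption]
        end; try reflexivity; exfalso; eauto.
  - intros a b a' b' c [H1|(u & v & Du & Dv & K1)] [H2|(u' & v' & Du' & Dv' & K2)].
    + exact (pg_inj GS _ _ _ _ _ H1 H2).
    + apply graph_in_square in H1 as (? & ? & ?).
      destruct K2 as [E|[E|E]]; injection E; intros; subst; exfalso;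
        match goal with K : D (k ?z) |- _ => apply (@kD z); auto 6 using coded_closed end.
    + apply graph_in_square in H2 as (? & ? & ?).
      destruct K1 as [E|[E|E]]; injection E; intros; subst; exfalso;
        match goal with K : D (k ?z) |- _ => apply (@kD z); auto 6 using coded_closed end.
    + destruct K1 as [E1|[E1|E1]], K2 as [E2|[E2|E2]];
        injection E1; injection E2; intros; subst;
        match goal with
        | E : k (f _ _) = k (f _ _) |- _ =>
            apply k_coded_inj in E; [destruct E as (? & ? & ?)|assumption..]
        end; subst; try (split; reflexivity); exfalso; congruence.
  - intros a b u v Ha Hb.
    destruct (proj1 (doubled_domain a) (ex_intro _ u Ha)) as [Da|(a' & Da & ->)];
      destruct (proj1 (doubled_domain b) (ex_intro _ v Hb)) as [Db|(b' & Db & ->)].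
    + exists (f a b); left; auto.
    + eexists; right; exists a, b'; eauto.
    + eexists; right; exists a', b; eauto.
    + eexists; right; exists a', b'; eauto 6.
  - intros a b c [H1|(u & v & Du & Dv & [E|[E|E]])]; apply doubled_domain;
      [apply graph_in_square in H1 as (? & ? & ?); auto|..]; injection E; intros; subst; eauto.
  - intros a b c [H1|(u & v & Du & Dv & [E|[E|E]])]; apply doubled_domain;
      [apply graph_in_square in H1 as (? & ? & ?); auto|..]; injection E; intros; subst;
      eauto 6 using coded_closed.
Qed.

End PairingDoubling.

(** Hessenberg's theorem. Take a maximal pairing on a square D × D, where D contains a copy of
    [nat]. If D embeds in its complement, doubling contradicts maximality. Otherwise the complement
    embeds in D, so X embeds in D and inherits the pairing. *)
Lemma card_le_square (X : Type) : card_le nat X -> card_le (X * X) X.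
Proof.
  intros [nu nuinj].
  pose (R0 := fun p : X * (X * X) => exists m n, p = (nu m, (nu n, nu (to_nat (m, n))))).
  assert (GR0 : pairing_graph R0).
  { split.
    - intros a b c c' (m & n & E) (m' & n' & E'); injection E; injection E'; intros; subst.
      repeat match goal with K : nu _ = nu _ |- _ => apply nuinj in K end; subst; auto.
    - intros a b a' b' c (m & n & E) (m' & n' & E').
      assert (K : nu (to_nat (m, n)) = nu (to_nat (m', n'))) by congruence.
      apply nuinj, to_nat_inj in K; split; congruence.
    - intros a b u v (m & n & E) (m' & n' & E'); injection E; injection E'; intros; subst.
      eexists; exists m, m'; reflexivity.
    - intros a b c (m & n & E); injection E; intros; subst.
      eexists; exists n, n; reflexivity.
    - intros a b c (m & n & E); injection E; intros; subst.
      eexists; eexists _, 0; reflexivity. }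
  (* Adjoining [R0] makes the empty relation admissible, as the empty chain demands, and keeps the
     image of [nu] in the domain. *)
  destruct (@zorn_sets _ (fun R : X * (X * X) -> Prop => pairing_graph (fun p => R p \/ R0 p)))
    as [R [GS Rmax]].
  { intros C CP Ctot. apply pairing_graph_directed.
    intros p q [[A [CA Ap]]|Hp] [[B [CB Bq]]|Hq].
    - destruct (Ctot A B CA CB) as [S|S].
      + exists (fun r => B r \/ R0 r); split; [exact (CP B CB)|split; [intros r [|]; eauto|auto]].
      + exists (fun r => A r \/ R0 r); split; [exact (CP A CA)|split; [intros r [|]; eauto|auto]].
    - exists (fun r => A r \/ R0 r); split; [exact (CP A CA)|split; [intros r [|]; eauto|auto]].
    - exists (fun r => B r \/ R0 r); split; [exact (CP B CB)|split; [intros r [|]; eauto|auto]].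
    - exists R0; auto. }
  set (S := fun p => R p \/ R0 p) in *.
  set (D := fun x => exists u, S (x, u)).
  assert (Dnu : forall n, D (nu n)).
  { intros n; eexists; right; exists n, n; reflexivity. }
  pose (f := fun a b => epsilon (inhabits (nu 0)) (fun c => S (a, (b, c)))).
  assert (Sf : forall a b, D a -> D b -> S (a, (b, f a b))).
  { intros a b [u Hu] [v Hv]; apply epsilon_spec; exact (pg_total GS _ _ _ _ Hu Hv). }
  destruct (card_le_total {x | D x} {x | ~ D x}) as [[k kinj]|[k kinj]].
  - exfalso.
    pose (k' := fun x => match excluded_middle_informative (D x) with
                         | left d => proj1_sig (k (exist _ x d)) | right _ => x end).
    assert (k'E : forall x (d : D x), k' x = proj1_sig (k (exist _ x d))).
    { intros x d; unfold k'; destruct (excluded_middle_informative (D x)) as [d'|n]; [|tauto].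
      rewrite (proof_irrelevance _ d' d); reflexivity. }
    assert (k'D : forall a, D a -> ~ D (k' a)).
    { intros a d; rewrite (k'E a d); exact (proj2_sig (k (exist _ a d))). }
    assert (k'inj : forall a b, D a -> D b -> k' a = k' b -> a = b).
    { intros a b Da Db; rewrite (k'E a Da), (k'E b Db); intros E.
      assert (E' : k (exist _ a Da) = k (exist _ b Db)).
      { apply eq_sig_hprop; [intros; apply proof_irrelevance|exact E]. }
      apply kinj in E'; injection E'; auto. }
    assert (ne : forall m n, m <> n -> nu m <> nu n) by (intros m n N E; auto).
    pose proof (@pairing_graph_doubled X S GS f Sf k' k'D k'inj (nu 0) (nu 1) (nu 2)
      (Dnu 0) (Dnu 1) (Dnu 2) (ne 0 1 ltac:(lia)) (ne 0 2 ltac:(lia)) (ne 1 2 ltac:(lia))) as GT.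
    set (T := doubled_graph _ _ _ _ _ _) in GT.
    assert (ST : forall p, S p -> T p) by (intros p Sp; left; exact Sp).
    assert (TR : forall p, T p -> R p).
    { apply (Rmax T).
      - replace (fun p => T p \/ R0 p) with T; [exact GT|].
        apply boolp.funext; intros p; apply boolp.propext; split; [tauto|].
        intros [|H0]; [assumption|apply ST; right; exact H0].
      - intros x Rx; apply ST; left; exact Rx. }
    (* By maximality the doubled graph lies in [R], so its new domain point [k' (nu 0)] would
       already be in [D]. *)
    apply (k'D _ (Dnu 0)). eexists; left; apply TR; right.
    exists (nu 0), (nu 0); do 2 (split; [apply Dnu|]); right; right; reflexivity.
  (* The tags [nu 0] and [nu 1] keep the images of [D] and of its complement apart. *)
  - pose (g := fun x => match excluded_middle_informative (D x) with
                        | left _ => f (nu 0) x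
                        | right n => f (nu 1) (proj1_sig (k (exist _ x n))) end).
    assert (Df : forall a b, D a -> D b -> D (f a b)).
    { intros a b Da Db; exact (pg_val GS _ _ _ (Sf _ _ Da Db)). }
    assert (finj : forall a b a' b', D a -> D b -> D a' -> D b' -> f a b = f a' b' -> a = a' /\ b = b').
    { intros a b a' b' Da Db Da' Db' E. pose proof (Sf _ _ Da Db) as H1. rewrite E in H1.
      exact (pg_inj GS _ _ _ _ _ H1 (Sf _ _ Da' Db')). }
    assert (Dk : forall z, D (proj1_sig (k z))) by (intros z; exact (proj2_sig (k z))).
    assert (gD : forall x, D (g x)).
    { intros x; unfold g; destruct (excluded_middle_informative (D x)); auto. }
    assert (ginj : forall x y, g x = g y -> x = y).
    { intros x y; unfold g; destruct (excluded_middle_informative (D x)) as [dx|dx];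
        destruct (excluded_middle_informative (D y)) as [dy|dy]; intros E;
        apply finj in E; auto; destruct E as [E1 E2]; auto.
      - apply nuinj in E1; discriminate.
      - apply nuinj in E1; discriminate.
      - assert (E' : k (exist _ x dx) = k (exist _ y dy)).
        { apply eq_sig_hprop; [intros; apply proof_irrelevance|exact E2]. }
        apply kinj in E'; injection E'; auto. }
    exists (fun p => f (g (fst p)) (g (snd p))).
    intros [a b] [a' b'] E; simpl in E.
    apply finj in E; auto. destruct E as [E1 E2]; apply ginj in E1, E2; congruence.
Qed.

Lemma card_le_prod (X X' Y Y' : Type) :
  card_le X X' -> card_le Y Y' -> card_le (X * Y) (X' * Y').
Proof.
  intros [f finj] [g ginj]; exists (fun p => (f (fst p), g (snd p))).
  intros [a b] [a' b'] E; injection E; intros; f_equal; auto.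
Qed.

Lemma card_le_list (X : Type) : card_le nat X -> card_le (list X) X.
Proof.
  intros natX. destruct (card_le_square natX) as [f finj].
  apply card_le_trans with (nat * X)%type.
  - destruct natX as [nu _].
    pose (enc := fold_right (fun x c => f (x, c)) (nu 0)).
    (* The iterated code alone does not show where a list ends, because [nu 0] may itself code a
       pair; hence the length. *)
    exists (fun l => (length l, enc l)).
    induction a as [|x l IH]; intros [|y m] E; try discriminate; [reflexivity|].
    injection E; intros E2 E1; apply finj in E2; injection E2; intros; subst.
    f_equal; apply IH; f_equal; assumption.
  - apply card_le_trans with (X * X)%type; [|exists f; exact finj].
    apply card_le_prod; [exact natX|exists (fun x => x); auto].
Qed.

Lemma card_le_list_map (X Y : Type) : card_le X Y -> card_le (list X) (list Y).
Proof.
  intros [f finj]; exists (map f).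
  induction a as [|x l IH]; intros [|y m] E; try discriminate; [reflexivity|].
  injection E; intros; f_equal; auto.
Qed.

Lemma card_le_Z_nat : card_le Z nat.
Proof.
  exists (fun z => to_nat (Z.to_nat z, Z.to_nat (- z))).
  intros a b E; apply to_nat_inj in E; injection E; lia.
Qed.

Lemma card_le_surj (X Y : Type) (f : X -> Y) :
  (forall y, exists x, f x = y) -> card_le Y X.
Proof.
  intros sur. exists (fun y => proj1_sig (constructive_indefinite_description _ (sur y))).
  intros a b E.
  rewrite <- (proj2_sig (constructive_indefinite_description _ (sur a))), E.
  exact (proj2_sig (constructive_indefinite_description _ (sur b))).
Qed.

Lemma card_le_list_Z (X Y : Type) :
  card_le nat Y -> card_le X Y -> card_le (list (X * Z)) Y.
Proof.
  intros natY XY.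
  apply card_le_trans with (list Y); [|apply card_le_list; exact natY].
  apply card_le_list_map.
  apply card_le_trans with (Y * Y)%type; [|apply card_le_square; exact natY].
  apply card_le_prod; [exact XY|exact (card_le_trans card_le_Z_nat natY)].
Qed.


(** * Sets that are eventually thin along a subgroup *)

Section Thin.
Variables (G : Type) (mul : G -> G -> G) (one : G) (inv : G -> G).
Hypothesis HG : is_group mul one inv.
Local Infix "**" := mul (at level 40, left associativity).

Lemma mulKg x y : inv x ** (x ** y) = y.
Proof. rewrite (mulA HG), (mulVg HG); apply (mul1g HG). Qed.

Lemma mulKVg x y : x ** (inv x ** y) = y.
Proof. rewrite (mulA HG), (mulgV HG); apply (mul1g HG). Qed.

Lemma mulg_injl x y z : x ** y = x ** z -> y = z.
Proof. intros E; rewrite <- (mulKg x y), E; apply mulKg. Qed.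

Lemma mulg_injr x y z : y ** x = z ** x -> y = z.
Proof.
  intros E. rewrite <- (mulg1 HG y), <- (mulgV HG x), (mulA HG), E, <- (mulA HG), (mulgV HG).
  apply (mulg1 HG).
Qed.

Lemma inv_eq x y : x ** y = one -> inv x = y.
Proof. intros E; apply (@mulg_injl x); rewrite E; apply (mulgV HG). Qed.

Lemma invMg x y : inv (x ** y) = inv y ** inv x.
Proof.
  apply inv_eq. rewrite <- (mulA HG x), mulKVg; apply (mulgV HG).
Qed.

Lemma lmulE x A g : lmul mul x A g <-> A (inv x ** g).
Proof.
  split.
  - intros (a & Aa & ->); rewrite mulKg; exact Aa.
  - intros Ag; exists (inv x ** g); rewrite mulKVg; auto.
Qed.

Lemma lmul_in x A g : A g -> lmul mul x A (x ** g).
Proof. intros Ag; exists g; auto. Qed.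

Variable H : G -> Prop.
Hypothesis Hsub : is_subgroup mul one inv H.
Hypothesis Hcomm : forall x y, H x -> H y -> x ** y = y ** x.
(* Stands in for torsion-freeness. *)
Hypothesis Hchar : forall g, H g -> g <> one ->
  exists c : G -> Z, (forall x, H x -> c (g ** x) = c g + c x)%Z /\ c g <> 0%Z.

Variable F : (G -> Prop) -> Prop.
Hypothesis Fid : is_ideal F.
Hypothesis Finv : left_invariant mul F.
Hypothesis Fempty : F (fun _ => False).

Let H1 : H one := proj1 Hsub.
Let HM x y : H x -> H y -> H (x ** y) := proj1 (proj2 Hsub) x y.
Let HV x : H x -> H (inv x) := proj2 (proj2 Hsub) x.
Let Fsubset := proj1 Fid.
Let Funion := proj2 Fid.

Inductive thin (A : G -> Prop) : Prop :=
| thin_base : F A -> thin A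
| thin_step : (forall g, H g -> g <> one -> thin (inter A (lmul mul g A))) -> thin A.

Lemma thin_subset A B : subset A B -> thin B -> thin A.
Proof.
  intros AB tB; revert A AB; induction tB as [B FB|B _ IH]; intros A AB.
  - apply thin_base; exact (Fsubset AB FB).
  - apply thin_step; intros g Hg ng; apply (IH g Hg ng).
    intros z [Az gz]; split; auto.
    apply lmulE; rewrite lmulE in gz; auto.
Qed.

(** As H is abelian, x(A ∩ gA) = xA ∩ g(xA). *)
Lemma thin_lmul x A : H x -> thin A -> thin (lmul mul x A).
Proof.
  intros Hx tA; induction tA as [A FA|A _ IH].
  - apply thin_base; auto.
  - apply thin_step; intros g Hg ng; apply (thin_subset (B := lmul mul x (inter A (lmul mul g A)))); auto.
    intros z [Az gz]. apply lmulE; split; [apply lmulE; exact Az|].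
    apply lmulE; rewrite !lmulE in gz.
    rewrite (mulA HG) in gz |- *. rewrite (Hcomm (HV Hg) (HV Hx)); exact gz.
Qed.

(** Closure under unions is immediate for this notion, unlike for [thin]. Every thin set turns out
    to be cothin, which is [thin_union]. *)
Definition cothin (A : G -> Prop) : Prop := forall C, thin C -> thin (union A C).

Lemma cothin_subset A B : subset A B -> cothin B -> cothin A.
Proof.
  intros AB cB C tC; apply (thin_subset (B := union B C)); auto.
  intros z [Az|Cz]; [left|right]; auto.
Qed.

Lemma cothin_union A B : cothin A -> cothin B -> cothin (union A B).
Proof.
  intros cA cB C tC; apply (thin_subset (B := union A (union B C))); auto.
  intros z [[|]|]; [left|right; left|right; right]; auto.
Qed.

Lemma cothin_lmul x A : H x -> cothin A -> cothin (lmul mul x A).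
Proof.
  intros Hx cA C tC.
  apply (thin_subset (B := lmul mul x (union A (lmul mul (inv x) C)))).
  - intros z [Az|Cz]; apply lmulE; [left; apply lmulE; exact Az|right].
    apply lmul_in; exact Cz.
  - apply thin_lmul, cA, thin_lmul; auto.
Qed.

(** Induction on the thinness of C, for all A in F at once: (A ∪ C) ∩ g(A ∪ C) lies in (A ∪ gA) ∪ (C
    ∩ gC), and A ∪ gA is again in F. *)
Lemma cothin_base A : F A -> cothin A.
Proof.
  intros FA C tC; revert A FA; induction tC as [C FC|C _ IH]; intros A FA.
  - apply thin_base; auto.
  - apply thin_step; intros g Hg ng.
    apply (thin_subset (B := union (union A (lmul mul g A)) (inter C (lmul mul g C)))); auto.
    intros z [Az gz]. rewrite lmulE in gz.
    destruct Az as [Az|Cz]; [left; left; exact Az|].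
    destruct gz as [gz|gz]; [left; right; apply lmulE; exact gz|].
    right; split; [exact Cz|apply lmulE; exact gz].
Qed.

Definition translates (xs : list G) (A : G -> Prop) : G -> Prop :=
  fun z => exists x, In x xs /\ lmul mul x A z.

(** Take x in the list minimizing c(g)c(x) for a character c with c(g) ≠ 0. Passing to the inverse
    shift of x lowers this value by c(g)², so it leaves the list. The factor c(g) treats both signs
    at once. *)
Lemma finite_not_periodic g xs : H g -> g <> one -> (forall x, In x xs -> H x) ->
  xs <> nil -> exists x, In x xs /\ ~ In (inv g ** x) xs.
Proof.
  intros Hg ng Hxs nil_xs.
  destruct (Hchar Hg ng) as (c & cg & c0).
  assert (cV : forall x, H x -> (c (inv g ** x) = c x - c g)%Z).
  { intros x Hx; rewrite <- (mulKVg g x) at 2; rewrite cg; auto; lia. }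
  assert (ext : forall s : Z, exists x, In x xs /\ forall y, In y xs -> (s * c x <= s * c y)%Z).
  { intros s. clear Hxs. induction xs as [|x [|x' xs'] IH]; [tauto| |].
    - exists x; split; [left; auto|]; intros y [<-|[]]; lia.
    - destruct IH as (m & Hm & mle); [discriminate|].
      destruct (Z_le_gt_dec (s * c x) (s * c m)) as [L|L].
      + exists x; split; [left; auto|]. intros y [<-|Hy]; [lia|]. specialize (mle y Hy); lia.
      + exists m; split; [right; auto|]. intros y [<-|Hy]; [lia|]. auto. }
  destruct (ext (c g)) as (x & Hx & xle).
  exists x; split; auto. intros K; specialize (xle _ K). rewrite cV in xle; auto. nia.
Qed.

Lemma cothin_bigunion (xs : list G) (D : G -> G -> Prop) :
  (forall x, In x xs -> cothin (D x)) -> cothin (fun z => exists x, In x xs /\ D x z).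
Proof.
  induction xs as [|x xs IH]; intros cD.
  - apply (cothin_subset (B := fun _ => False)); [intros z (y & [] & _)|].
    apply cothin_base, Fempty.
  - apply (cothin_subset (B := union (D x) (fun z => exists y, In y xs /\ D y z))).
    + intros z (y & [<-|Hy] & Dz); [left; auto|right; eauto].
    + apply cothin_union; [apply cD; left; auto|apply IH; intros y Hy; apply cD; right; auto].
Qed.

(* Modulo cothin sets, the translates of [A] are pairwise disjoint, so that meeting with a shift
   strictly decreases the number of translates involved. *)
Lemma translates_thin A :
  (forall g, H g -> g <> one -> cothin (inter A (lmul mul g A))) ->
  forall n xs, length xs <= n -> (forall x, In x xs -> H x) -> thin (translates xs A).
Proof.
  intros tA; induction n as [|n IH]; intros xs len Hxs.
  { destruct xs; [|simpl in len; lia].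
    apply (thin_subset (B := fun _ => False)); [intros z (x & [] & _)|apply thin_base, Fempty]. }
  destruct (classic (xs = nil)) as [->|nil_xs].
  { apply IH; [simpl; lia|auto]. }
  apply thin_step; intros g Hg ng.
  (* A piece xA ∩ gyA is cothin unless x = gy, so the only translates that matter are those with
     [inv g ** x] in [xs]. *)
  pose (keep := fun x => if excluded_middle_informative (In (inv g ** x) xs) then true else false).
  assert (keepE : forall x, keep x = true <-> In (inv g ** x) xs).
  { intros x; unfold keep; destruct (excluded_middle_informative _); split; auto; discriminate. }
  pose (ys := filter keep xs).
  assert (cothinD : cothin (fun z => exists x, In x xs /\ exists y, In y xs /\
             (x <> g ** y /\ lmul mul x A z /\ lmul mul (g ** y) A z))).
  { apply cothin_bigunion; intros x Hx; apply cothin_bigunion; intros y Hy.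
    destruct (classic (x = g ** y)) as [E|E].
    { apply (cothin_subset (B := fun _ => False)); [intros z [? _]; auto|apply cothin_base, Fempty]. }
    (* With h = x⁻¹gy ≠ 1, the piece is the x-translate of A ∩ hA, to which the hypothesis on A
       applies. *)
    apply (cothin_subset (B := lmul mul x (inter A (lmul mul (inv x ** (g ** y)) A)))).
    - intros z (_ & Hz & Kz); apply lmulE; rewrite lmulE in Hz; rewrite lmulE in Kz.
      split; [exact Hz|]. apply lmulE.
      replace (inv (inv x ** (g ** y)) ** (inv x ** z)) with (inv (g ** y) ** z); [exact Kz|].
      apply (@mulg_injl (inv x ** (g ** y))). rewrite mulKVg, <- (mulA HG), mulKVg; reflexivity.
    - apply cothin_lmul; auto. apply tA; auto.
      intros K; apply E. rewrite <- (mulKVg x (g ** y)), K; symmetry; apply (mulg1 HG). }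
  apply (thin_subset (B := union (fun z => exists x, In x xs /\ exists y, In y xs /\
             (x <> g ** y /\ lmul mul x A z /\ lmul mul (g ** y) A z)) (translates ys A))).
  - intros z [(x & Hx & xz) gz]. rewrite lmulE in gz. destruct gz as (y & Hy & yz).
    assert (gyz : lmul mul (g ** y) A z).
    { apply lmulE; rewrite lmulE in yz; rewrite invMg, <- (mulA HG); exact yz. }
    destruct (classic (x = g ** y)) as [E|E].
    + right; exists x; split; auto. apply filter_In; split; auto. apply keepE.
      rewrite E, mulKg; exact Hy.
    + left; exists x; split; auto; exists y; auto.
  - apply cothinD. apply IH.
    + assert (length ys < length xs); [|lia].
      destruct (finite_not_periodic Hg ng Hxs nil_xs) as (x & Hx & nx).
      destruct (in_split _ _ Hx) as (l1 & l2 & E). unfold ys; rewrite E, filter_app; simpl.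
      destruct (keep x) eqn:Kx; [apply keepE in Kx; contradiction|].
      rewrite !length_app; simpl.
      pose proof (filter_length_le keep l1); pose proof (filter_length_le keep l2); lia.
    + intros x Hx; apply filter_In in Hx as [Hx _]; auto.
Qed.

(** Induction on the thinness of C, for all finite lists of translates simultaneously: meeting with
    the shift by g replaces [xs] by [xs] together with g[xs], and C by C ∩ gC. Once C is in F,
    [translates_thin] finishes. *)
Lemma cothin_step A :
  (forall g, H g -> g <> one -> cothin (inter A (lmul mul g A))) -> cothin A.
Proof.
  intros tA.
  assert (main : forall C, thin C -> forall xs, (forall x, In x xs -> H x) ->
            thin (union (translates xs A) C)).
  { intros C tC; induction tC as [C FC|C _ IH]; intros xs Hxs.
    - apply (thin_subset (B := union C (translates xs A))); [intros z [|]; [right|left]; auto|].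
      apply cothin_base; auto. apply (translates_thin tA (n := length xs)); auto.
    - apply thin_step; intros g Hg ng.
      apply (thin_subset (B := union (translates (xs ++ map (mul g) xs) A) (inter C (lmul mul g C)))).
      + intros z [[(x & Hx & xz)|Cz] gz].
        { left; exists x; split; auto; apply in_or_app; auto. }
        rewrite lmulE in gz; destruct gz as [(x & Hx & xz)|gz].
        * left; exists (g ** x); split; [apply in_or_app; right; apply in_map; auto|].
          apply lmulE; rewrite lmulE in xz; rewrite invMg, <- (mulA HG); exact xz.
        * right; split; auto; apply lmulE; auto.
      + apply IH; auto. intros x Hx; apply in_app_or in Hx as [Hx|Hx]; auto.
        apply in_map_iff in Hx as (y & <- & Hy); auto. }
  intros C tC; apply (thin_subset (B := union (translates (one :: nil) A) C)).
  - intros z [Az|Cz]; [left|right; auto].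
    exists one; split; [left; auto|]. exists z; split; auto; symmetry; apply (mul1g HG).
  - apply main; auto. intros x [<-|[]]; auto.
Qed.

Lemma thin_union A B : thin A -> thin B -> thin (union A B).
Proof.
  intros tA; revert B; change (cothin A).
  induction tA as [A FA|A _ IH]; [apply cothin_base; exact FA|apply cothin_step; exact IH].
Qed.

Lemma thin_bigunion (I : Type) (l : list I) (D : I -> G -> Prop) :
  (forall i, In i l -> thin (D i)) -> thin (fun z => exists i, In i l /\ D i z).
Proof.
  induction l as [|i l IH]; intros tD.
  - apply (thin_subset (B := fun _ => False)); [intros z (y & [] & _)|apply thin_base, Fempty].
  - apply (thin_subset (B := union (D i) (fun z => exists j, In j l /\ D j z))).
    + intros z (y & [<-|Hy] & Dz); [left; auto|right; eauto].
    + apply thin_union; [apply tD; left; auto|apply IH; intros j Hj; apply tD; right; auto].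
Qed.

(** A fixed point of [tau] is invariant under left translations. If x and y lie in the same left
    coset of H, then xA ∩ yA is a translate of A ∩ gA with g = x⁻¹y in H; otherwise it is empty,
    because A is contained in H. *)
Lemma thin_in_fixpoint (X : (G -> Prop) -> Prop) A :
  (forall B, F B -> X B) -> fam_eq (tau mul X) X -> subset A H -> thin A -> X A.
Proof.
  intros FX fixX AH tA.
  assert (Xlmul : forall z B, X B -> X (lmul mul z B)).
  { intros z B XB; apply fixX; apply fixX in XB; intros x y ne.
    replace (inter (lmul mul x (lmul mul z B)) (lmul mul y (lmul mul z B)))
      with (inter (lmul mul (x ** z) B) (lmul mul (y ** z) B)).
    - apply XB; intros E; apply ne; exact (mulg_injr E).
    - apply boolp.funext; intros g; apply boolp.propext; unfold inter; rewrite !lmulE, !invMg, !(mulA HG).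
      reflexivity. }
  induction tA as [A FA|A _ IH]; [auto|].
  apply fixX; intros x y ne.
  destruct (classic (H (inv x ** y))) as [Hg|Hg].
  - replace (inter (lmul mul x A) (lmul mul y A))
      with (lmul mul x (inter A (lmul mul (inv x ** y) A))).
    + apply Xlmul, IH; auto.
      * intros E; apply ne; rewrite <- (mulKVg x y), E; symmetry; apply (mulg1 HG).
      * intros z [Az _]; auto.
    + apply boolp.funext; intros g; apply boolp.propext; unfold inter.
      rewrite !lmulE, invMg, <- !(mulA HG), mulKg; reflexivity.
  - apply FX, (Fsubset (B := fun _ => False)); auto.
    intros g [xg yg]; rewrite lmulE in xg, yg; apply Hg.
    replace (inv x ** y) with ((inv x ** g) ** inv (inv y ** g)); auto.
    rewrite invMg, <- !(mulA HG), mulKVg; f_equal.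
    apply inv_eq; apply (mulVg HG).
Qed.

(** * Images under injective endomorphisms of H *)

Definition injective_endo (phi : G -> G) : Prop :=
  (forall x, H x -> H (phi x)) /\
  (forall x y, H x -> H y -> phi (x ** y) = phi x ** phi y) /\
  (forall x y, H x -> H y -> phi x = phi y -> x = y).

Hypothesis Fiso : forall (H1 K1 : G -> Prop) (h : G -> G),
  subgroup_iso mul one inv H1 K1 h -> subset K1 H1 -> h_invariant F H1 h.

Lemma endo_one phi : injective_endo phi -> phi one = one.
Proof.
  intros (_ & phiM & _); apply (@mulg_injl (phi one)); rewrite <- phiM, !(mulg1 HG); auto.
Qed.

Lemma endo_inv phi x : injective_endo phi -> H x -> phi (inv x) = inv (phi x).
Proof.
  intros ephi Hx; symmetry; apply inv_eq. rewrite <- (proj1 (proj2 ephi)), (mulgV HG); auto.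
  apply endo_one; exact ephi.
Qed.

(** Sub-invariance applies because phi is an isomorphism of H onto phi(H), a subgroup contained in
    H. *)
Lemma base_image phi A : injective_endo phi -> subset A H -> F A <-> F (image phi A).
Proof.
  intros ephi; pose proof ephi as (phiH & phiM & phiI).
  apply (Fiso (K1 := image phi H)).
  - repeat split; auto.
    + exists one; split; auto; symmetry; apply endo_one; auto.
    + intros x y (a & Ha & ->) (b & Hb & ->); exists (a ** b); split; auto; symmetry; auto.
    + intros x (a & Ha & ->); exists (inv a); split; auto; symmetry; apply endo_inv; auto.
    + intros x Hx; exists x; auto.
    + intros z (a & Ha & ->); exists a; auto.
  - intros z (a & Ha & ->); auto.
Qed.

(** For g = phi(g'), the set phi(A) ∩ g phi(A) lies in phi(A ∩ g'A). For g outside phi(H) it is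
    empty, since a common point would exhibit g as a quotient of two values of phi. *)
Lemma thin_image phi A : injective_endo phi -> subset A H -> thin A -> thin (image phi A).
Proof.
  intros ephi; pose proof ephi as (phiH & phiM & phiI). intros AH tA.
  induction tA as [A FA|A _ IH]; [apply thin_base, base_image; auto|].
  apply thin_step; intros g Hg ng.
  destruct (classic (exists g', H g' /\ g = phi g')) as [(g' & Hg' & ->)|out].
  - apply (thin_subset (B := image phi (inter A (lmul mul g' A)))).
    + intros z [(a & Aa & ->) (z' & (b & Ab & ->) & E)]. exists a; split; auto.
      split; auto. exists b; split; auto. apply phiI; auto. rewrite phiM; auto.
    + apply IH; auto.
      * intros ->; apply ng, endo_one; auto.
      * intros z [Az _]; auto.
  - apply (thin_subset (B := fun _ => False)); [|apply thin_base, Fempty].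
    intros z [(a & Aa & ->) (z' & (b & Ab & ->) & E)]. apply out.
    exists (a ** inv b); split; auto.
    rewrite phiM, E, endo_inv, <- (mulA HG), (mulgV HG); auto. symmetry; apply (mulg1 HG).
Qed.

(** The case i = j is included: for i outside [l], the element g is not a value of [phi i] on H. *)
Definition independent_endos (I : Type) (phi : I -> G -> G) : Prop :=
  (forall i, injective_endo (phi i)) /\
  forall g, H g -> g <> one -> exists l : list I, forall i j u v, H u -> H v ->
    phi i u = g ** phi j v -> In i l \/ In j l.

(** Let V be the part of the union U with indices in the finite list for g. Then U ∩ gU lies in V ∪
    gV, a finite union of thin sets. *)
Lemma thin_independent_union (I : Type) (phi : I -> G -> G) (D : I -> G -> Prop) :
  independent_endos phi -> (forall i, subset (D i) H) -> (forall i, thin (D i)) ->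
  thin (fun z => exists i, image (phi i) (D i) z).
Proof.
  intros [ephi indep] DH tD; apply thin_step; intros g Hg ng.
  destruct (indep g Hg ng) as [l Hl].
  set (V := fun z => exists i, In i l /\ image (phi i) (D i) z).
  assert (tV : thin V).
  { apply thin_bigunion; intros i _; apply thin_image; auto. }
  apply (thin_subset (B := union V (lmul mul g V))).
  - intros z [(i & a & Da & Ea) (z' & (j & b & Db & Eb) & E)].
    destruct (Hl i j a b) as [Li|Lj]; [eapply DH; eauto..|congruence| |].
    + left; exists i; split; auto; exists a; auto.
    + right; exists z'; split; auto. exists j; split; auto; exists b; auto.
  - apply thin_union; auto; apply thin_lmul; auto.
Qed.

(** * Thin sets and the transfinite iteration *)

Section Iteration.
Variables (W : Type) (lt : W -> W -> Prop).
Hypothesis WO : well_order lt.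

Lemma base_tau_iter s A : F A -> tau_iter mul F lt s A.
Proof.
  revert A; induction (wo_wf WO s) as [s _ IH]; intros A FA.
  destruct (classic (exists r, lt r s)) as [[r rs]|least].
  - apply ti_succ; [eauto|]. intros x y _; exists r; split; auto. apply IH; auto.
    apply (Fsubset (B := lmul mul x A)); auto. intros z [? _]; auto.
  - apply ti_zero; auto. intros r rs; eauto.
Qed.

Lemma tau_iter_subset s A B : subset A B -> tau_iter mul F lt s B -> tau_iter mul F lt s A.
Proof.
  revert A B; induction (wo_wf WO s) as [s _ IH]; intros A B AB tB.
  destruct tB as [s B least FB|s B ex tB]; [apply ti_zero; eauto|].
  apply ti_succ; auto. intros x y ne; destruct (tB x y ne) as (r & rs & tr).
  exists r; split; auto. refine (IH r rs _ _ _ tr).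
  intros z [xz yz]; rewrite lmulE in xz, yz; split; rewrite lmulE; auto.
Qed.

Lemma tau_iter_lmul s x A : tau_iter mul F lt s A -> tau_iter mul F lt s (lmul mul x A).
Proof.
  intros tA; destruct tA as [s A least FA|s A ex tA]; [apply ti_zero; auto|].
  apply ti_succ; auto. intros y z ne.
  destruct (tA (y ** x) (z ** x)) as (r & rs & tr).
  - intros E; apply ne; exact (mulg_injr E).
  - exists r; split; auto. refine (tau_iter_subset _ tr).
    intros g [yg zg]; rewrite !lmulE in yg, zg; split; rewrite lmulE, invMg, <- (mulA HG); auto.
Qed.

(** Induction on s. For g = x⁻¹y in H, xA ∩ yA is the x-translate of A ∩ gA, and phi(A ∩ gA) lies in
    phi(A) ∩ phi(g)phi(A), which is in an earlier level as phi(g) ≠ 1. For x⁻¹y outside H the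
    intersection is empty. *)
Lemma tau_iter_image phi s A : injective_endo phi -> subset A H ->
  tau_iter mul F lt s (image phi A) -> tau_iter mul F lt s A.
Proof.
  intros ephi; pose proof ephi as (phiH & phiM & phiI).
  revert A; induction (wo_wf WO s) as [s _ IH]; intros A AH tA.
  remember (image phi A) as P eqn:EP.
  destruct tA as [s P least FP|s P ex tP]; subst P.
  - apply ti_zero; auto. apply (base_image ephi); auto.
  - apply ti_succ; auto. intros x y ne.
    destruct (classic (H (inv x ** y))) as [Hg|Hg].
    + set (g := inv x ** y) in *.
      assert (Ey : y = x ** g) by (symmetry; apply mulKVg).
      assert (ng : g <> one).
      { intros E; apply ne; rewrite Ey, E; symmetry; apply (mulg1 HG). }
      destruct (tP one (phi g)) as (r & rs & tr).
      { intros E; apply ng. apply phiI; auto. rewrite endo_one; auto. }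
      exists r; split; auto.
      apply (tau_iter_subset (B := lmul mul x (inter A (lmul mul g A)))).
      * rewrite Ey; intros z [xz yz]; rewrite lmulE in xz, yz |- *; split; auto.
        rewrite lmulE, (mulA HG), <- invMg; auto.
      * apply tau_iter_lmul, IH; auto; [intros z [Az _]; auto|].
        refine (tau_iter_subset _ tr).
        intros z (a & [Aa (b & Ab & Ea)] & ->); split.
        -- exists (phi a); split; [exists a; auto|symmetry; apply (mul1g HG)].
        -- exists (phi b); split; [exists b; auto|]. rewrite Ea; auto.
    + destruct ex as [r rs]; exists r; split; auto. apply base_tau_iter.
      apply (Fsubset (B := fun _ => False)); auto.
      intros g [xg yg]; rewrite lmulE in xg, yg; apply Hg.
      replace (inv x ** y) with ((inv x ** g) ** inv (inv y ** g)); auto.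
      rewrite invMg, <- !(mulA HG), mulKVg; f_equal.
      apply inv_eq; apply (mulVg HG).
Qed.

Lemma thin_not_tau_iter (I : Type) (phi : I -> G -> G) (e : W -> I) (A0 : G -> Prop) (x0 : G) :
  independent_endos phi -> (forall a b, e a = e b -> a = b) ->
  subset A0 H -> thin A0 -> ~ F A0 -> H x0 -> x0 <> one ->
  forall t, exists A, subset A H /\ thin A /\ ~ tau_iter mul F lt t A.
Proof.
  intros indep einj A0H tA0 nA0 Hx0 nx0 t.
  induction (wo_wf WO t) as [t _ IH].
  (* The last clause is conditional so that the empty set can serve for every s that is not below
     t. *)
  pose (A := fun s => epsilon (inhabits (fun _ : G => False)) (fun A => subset A H /\ thin A /\
                        (lt s t -> ~ tau_iter mul F lt s A))).
  assert (AP : forall s, subset (A s) H /\ thin (A s) /\ (lt s t -> ~ tau_iter mul F lt s (A s))).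
  { intros s; apply epsilon_spec. destruct (classic (lt s t)) as [st|nst].
    - destruct (IH s st) as (B & ? & ? & ?); exists B; auto.
    - exists (fun _ => False); split; [intros z []|split; [apply thin_base, Fempty|contradiction]]. }
  (* Since [e] is injective, [D i] is a single [A s], or empty when i is outside the range of
     [e]. *)
  pose (D := fun i z => exists s, e s = i /\ A s z).
  assert (DH : forall i, subset (D i) H).
  { intros i z (s & _ & Az); exact (proj1 (AP s) z Az). }
  assert (tD : forall i, thin (D i)).
  { intros i; destruct (classic (exists s, e s = i)) as [[s es]|none].
    - apply (thin_subset (B := A s)); [|apply AP].
      intros z (s' & es' & Az); replace s with s'; auto; apply einj; congruence.
    - apply (thin_subset (B := fun _ => False)); [intros z (s & es & _); eauto|apply thin_base, Fempty]. }
  set (U := fun z => exists i, image (phi i) (D i) z).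
  assert (tU : thin U) by (apply thin_independent_union; auto).
  assert (UH : subset U H).
  { intros z (i & a & Da & ->); apply indep, (DH i); exact Da. }
  exists (union (union U (lmul mul x0 U)) A0). split; [|split].
  - intros z [[Uz|(u & Uu & ->)]|Az]; auto.
  - apply thin_union; auto; apply thin_union; auto; apply thin_lmul; auto.
  - intros K; remember (union (union U (lmul mul x0 U)) A0) as P eqn:EP.
    destruct K as [t P least FP|t P ex tP]; subst P.
    (* At the least t the piece [A0] keeps the set out of F. *)
    + apply nA0, (Fsubset (B := union (union U (lmul mul x0 U)) A0)); auto.
      intros z Az; right; exact Az.
    (* The intersection for the pair [x0], [one] would lie in some level s below t. It contains the
       [x0]-translate of the image of [A s], so [A s] would lie in level s as well. *)
    + destruct (tP x0 one nx0) as (s & st & ts).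
      apply (proj2 (proj2 (AP s)) st).
      apply (tau_iter_image (phi := phi (e s))); [apply indep|apply AP|].
      apply (tau_iter_subset (B := lmul mul (inv x0) (lmul mul x0 (image (phi (e s)) (A s))))).
      { intros z Hz; rewrite !lmulE, mulKVg; exact Hz. }
      apply tau_iter_lmul. refine (tau_iter_subset _ ts).
      intros z Hz.
      assert (zU : lmul mul x0 U z).
      { destruct Hz as (a & (b & Ab & ->) & ->); apply lmul_in.
        exists (e s), b; split; auto; exists s; auto. }
      split.
      * destruct zU as (u & Uu & ->); apply lmul_in; left; left; exact Uu.
      * exists z; split; [left; right; exact zU|symmetry; apply (mul1g HG)].
Qed.

End Iteration.

Lemma thin_tau A : tau mul F A -> thin A.
Proof.
  intros tA; apply thin_step; intros g Hg ng; apply thin_base.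
  apply (Fsubset (B := inter (lmul mul one A) (lmul mul g A))); auto.
  intros z [Az gz]; split; auto; exists z; split; auto; symmetry; apply (mul1g HG).
Qed.

End Thin.


(** * Coordinates in a free abelian subgroup *)

Section Basis.
Variables (G : Type) (mul : G -> G -> G) (one : G) (inv : G -> G).
Hypothesis HG : is_group mul one inv.
Local Infix "**" := mul (at level 40, left associativity).
Local Notation zpow := (zpow mul one inv).
Local Notation zcomb := (zcomb mul one inv).

Lemma npow_comm g n : npow mul one g n ** g = g ** npow mul one g n.
Proof.
  induction n as [|n IH]; simpl.
  - rewrite (mul1g HG), (mulg1 HG); reflexivity.
  - rewrite <- (mulA HG), IH; reflexivity.
Qed.

Lemma invg1 : inv one = one.
Proof. apply (inv_eq HG); apply (mul1g HG). Qed.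

Lemma zpow_nat g n : zpow g (Z.of_nat n) = npow mul one g n.
Proof.
  destruct n as [|n]; [reflexivity|]. simpl Z.of_nat; unfold Defs.zpow.
  rewrite SuccNat2Pos.id_succ; reflexivity.
Qed.

Lemma zpow_opp_nat g n : zpow g (- Z.of_nat n) = inv (npow mul one g n).
Proof.
  destruct n as [|n]; [symmetry; apply invg1|]. simpl Z.of_nat; unfold Defs.zpow; simpl Z.opp.
  cbv iota; rewrite SuccNat2Pos.id_succ; reflexivity.
Qed.

Lemma zpow_succ g z : zpow g (Z.succ z) = g ** zpow g z.
Proof.
  destruct (Z_le_gt_dec 0 z) as [L|L].
  - rewrite <- (Z2Nat.id z L), <- Nat2Z.inj_succ, !zpow_nat; reflexivity.
  - replace z with (- Z.of_nat (S (Z.to_nat (- z - 1))))%Z by lia.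
    set (n := Z.to_nat _).
    replace (Z.succ (- Z.of_nat (S n)))%Z with (- Z.of_nat n)%Z by lia.
    rewrite !zpow_opp_nat; simpl npow. rewrite <- npow_comm, (invMg HG), (mulKVg HG); reflexivity.
Qed.

Lemma zpow_add g a b : zpow g (a + b) = zpow g a ** zpow g b.
Proof.
  revert a; apply Z.peano_ind.
  - symmetry; apply (mul1g HG).
  - intros a IH; rewrite Z.add_succ_l, !zpow_succ, IH; apply (mulA HG).
  - intros a IH. apply (@mulg_injl _ _ _ _ HG g).
    rewrite (mulA HG), <- !zpow_succ, <- Z.add_succ_l, Z.succ_pred; exact IH.
Qed.

Lemma zpow_opp g a : zpow g (- a) = inv (zpow g a).
Proof.
  symmetry; apply (inv_eq HG); rewrite <- zpow_add, Z.add_opp_diag_r; reflexivity.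
Qed.

Lemma zcomb_app l l' : zcomb (l ++ l') = zcomb l ** zcomb l'.
Proof.
  induction l as [|p l IH]; simpl; [symmetry; apply (mul1g HG)|].
  rewrite IH; apply (mulA HG).
Qed.

Definition coef (b : G) (l : list (G * Z)) : Z :=
  fold_right (fun p acc => if excluded_middle_informative (fst p = b) then snd p + acc else acc)%Z
    0%Z l.

Lemma coef_app b l l' : coef b (l ++ l') = (coef b l + coef b l')%Z.
Proof.
  induction l as [|p l IH]; simpl; [reflexivity|].
  rewrite IH; destruct (excluded_middle_informative (fst p = b)); lia.
Qed.

Lemma coef_in b l : coef b l <> 0%Z -> In b (map fst l).
Proof.
  induction l as [|p l IH]; simpl; [lia|].
  destruct (excluded_middle_informative (fst p = b)); auto.
Qed.

Definition opp_comb (l : list (G * Z)) := map (fun p => (fst p, - snd p)%Z) l.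

Lemma coef_opp b l : coef b (opp_comb l) = (- coef b l)%Z.
Proof.
  induction l as [|p l IH]; simpl; [reflexivity|].
  rewrite IH; destruct (excluded_middle_informative (fst p = b)); lia.
Qed.

Variable H : G -> Prop.
Hypothesis Hsub : is_subgroup mul one inv H.
Hypothesis Hcomm : forall x y, H x -> H y -> x ** y = y ** x.
Let H1 : H one := proj1 Hsub.
Let HM x y : H x -> H y -> H (x ** y) := proj1 (proj2 Hsub) x y.
Let HV x : H x -> H (inv x) := proj2 (proj2 Hsub) x.

Variable B : G -> Prop.
Hypothesis BH : forall b, B b -> H b.
Hypothesis Bspan : forall h, H h -> exists l : list (G * Z),
  Forall (fun p => B (fst p)) l /\ h = zcomb l.
Hypothesis Bfree : forall l : list (G * Z),
  Forall (fun p => B (fst p) /\ snd p <> 0%Z) l ->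
  NoDup (map (@fst G Z) l) -> zcomb l = one -> l = nil.

Local Notation over_B := (Forall (fun p : G * Z => B (fst p))).

Lemma zpow_mem x z : H x -> H (zpow x z).
Proof.
  intros Hx; revert z; apply Z.peano_ind.
  - exact H1.
  - intros z Hz; rewrite zpow_succ; auto.
  - intros z Hz. rewrite <- (mulKg HG x (zpow x _)), <- zpow_succ, Z.succ_pred; auto.
Qed.

Lemma zcomb_mem l : over_B l -> H (zcomb l).
Proof.
  induction 1 as [|p l Bp _ IH]; [exact H1|]. apply HM; [apply zpow_mem|]; auto.
Qed.

Lemma zcomb_opp l : over_B l -> zcomb (opp_comb l) = inv (zcomb l).
Proof.
  induction 1 as [|p l Bp Bl IH]; simpl; [symmetry; apply invg1|].
  rewrite IH, (invMg HG), zpow_opp. apply Hcomm; apply HV; [apply zpow_mem|apply zcomb_mem]; auto.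
Qed.

(** [Bfree] speaks only of lists without repetitions and zero exponents. A head whose generator
    already occurs is merged into that entry, which is dropped if the exponents cancel. *)
Lemma zcomb_normal_form l : over_B l -> exists l',
  Forall (fun p => B (fst p) /\ snd p <> 0%Z) l' /\ NoDup (map (@fst G Z) l') /\
  zcomb l = zcomb l' /\ forall b, coef b l = coef b l'.
Proof.
  induction 1 as [|[x z] l Bx Bl (l' & Fl' & Nl' & El & Cl)].
  { exists nil; repeat split; constructor. }
  simpl in Bx. destruct (Z.eq_dec z 0) as [->|nz].
  { exists l'; split; [|split; [|split]]; auto.
    - simpl; rewrite (mul1g HG); exact El.
    - intros b; simpl; rewrite Cl; destruct (excluded_middle_informative (x = b)); reflexivity. }
  destruct (classic (In x (map fst l'))) as [inx|outx].
  - apply in_map_iff in inx as ([x' w] & Ex & inx); simpl in Ex; subst x'.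
    destruct (in_split _ _ inx) as (l1 & l2 & El'). subst l'.
    rewrite map_app in Nl'; simpl in Nl'.
    pose proof (NoDup_remove_1 _ _ _ Nl') as N1.
    apply Forall_app in Fl' as [F1 F2]. pose proof (Forall_inv_tail F2) as F3.
    assert (B1 : over_B l1) by (eapply Forall_impl; [|exact F1]; intros q [Bq _]; exact Bq).
    assert (E : zcomb ((x, z) :: l) = zcomb l1 ** (zpow x (z + w) ** zcomb l2)).
    { simpl; rewrite El, zcomb_app; simpl. rewrite zpow_add, <- (mulA HG (zpow x z)).
      rewrite !(mulA HG); do 2 f_equal. apply Hcomm; [apply zpow_mem|apply zcomb_mem]; auto. }
    assert (C : forall b, coef b ((x, z) :: l) = (coef b l1 + coef b ((x, z + w) :: l2))%Z).
    { intros b; simpl; rewrite Cl, coef_app; simpl.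
      destruct (excluded_middle_informative (x = b)); lia. }
    destruct (Z.eq_dec (z + w) 0) as [s0|ns].
    + exists (l1 ++ l2); split; [apply Forall_app; auto|split; [rewrite map_app; auto|split]].
      * rewrite E, s0, zcomb_app; simpl. rewrite (mul1g HG); reflexivity.
      * intros b; rewrite C, coef_app; simpl; rewrite s0.
        destruct (excluded_middle_informative (x = b)); reflexivity.
    + exists (l1 ++ (x, z + w)%Z :: l2); split; [|split; [|split]].
      * apply Forall_app; split; auto.
      * rewrite map_app; exact Nl'.
      * rewrite E, zcomb_app; reflexivity.
      * intros b; rewrite C, coef_app; reflexivity.
  - exists ((x, z) :: l'); split; [|split; [|split]].
    + constructor; auto.
    + simpl; constructor; auto.
    + simpl; rewrite El; reflexivity.
    + intros b; simpl; rewrite Cl; reflexivity.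
Qed.

Lemma zcomb_eq_one l : over_B l -> zcomb l = one <-> forall b, coef b l = 0%Z.
Proof.
  intros Bl; destruct (zcomb_normal_form Bl) as (l' & Fl' & Nl' & El & Cl).
  split.
  - intros E b; rewrite Cl, (Bfree Fl' Nl'); [reflexivity|congruence].
  - intros C; rewrite El. destruct l' as [|[x z] l']; [reflexivity|exfalso].
    specialize (C x); rewrite Cl in C; simpl in C, Nl'.
    apply NoDup_cons_iff in Nl' as [nx _].
    destruct (excluded_middle_informative (x = x)) as [_|]; [|tauto].
    apply Forall_inv in Fl' as [_ nz]; simpl in nz.
    apply nx, coef_in; lia.
Qed.

Lemma zcomb_eq l l' : over_B l -> over_B l' ->
  zcomb l = zcomb l' <-> forall b, coef b l = coef b l'.
Proof.
  intros Bl Bl'.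
  assert (Bo : over_B (opp_comb l')).
  { apply Forall_map; exact Bl'. }
  assert (Ba : over_B (l ++ opp_comb l')) by (apply Forall_app; auto).
  pose proof (zcomb_eq_one Ba) as K. rewrite zcomb_app, zcomb_opp in K; auto.
  split.
  - intros E b. rewrite E, (mulgV HG) in K. pose proof (proj1 K eq_refl b) as C.
    rewrite coef_app, coef_opp in C; lia.
  - intros C. apply (@mulg_injr _ _ _ _ HG (inv (zcomb l'))). rewrite (mulgV HG). apply K.
    intros b; rewrite coef_app, coef_opp, C; lia.
Qed.

(** An arbitrary choice; by [zcomb_eq] the coefficients do not depend on it. *)
Definition rep (h : G) : list (G * Z) :=
  epsilon (inhabits nil) (fun l => over_B l /\ h = zcomb l).

Lemma rep_spec h : H h -> over_B (rep h) /\ h = zcomb (rep h).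
Proof. intros Hh; unfold rep; apply epsilon_spec; exact (Bspan Hh). Qed.

Definition coord (b h : G) : Z := coef b (rep h).

Lemma coord_zcomb b l : over_B l -> coord b (zcomb l) = coef b l.
Proof.
  intros Bl; destruct (rep_spec (zcomb_mem Bl)) as [Br Er].
  apply zcomb_eq; auto.
Qed.

Lemma coordM b x y : H x -> H y -> coord b (x ** y) = (coord b x + coord b y)%Z.
Proof.
  intros Hx Hy; destruct (rep_spec Hx) as [Bx Ex]; destruct (rep_spec Hy) as [By Ey].
  rewrite Ex at 1; rewrite Ey at 1. rewrite <- zcomb_app, coord_zcomb, coef_app; [reflexivity|].
  apply Forall_app; auto.
Qed.

Lemma coord_ext x y : H x -> H y -> (forall b, coord b x = coord b y) -> x = y.
Proof.
  intros Hx Hy C; destruct (rep_spec Hx) as [Bx Ex]; destruct (rep_spec Hy) as [By Ey].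
  rewrite Ex, Ey; apply zcomb_eq; auto.
Qed.

Lemma coord_one b : coord b one = 0%Z.
Proof. apply (coord_zcomb b (l := nil)); constructor. Qed.

Lemma coord_nontrivial g : H g -> g <> one -> exists b, coord b g <> 0%Z.
Proof.
  intros Hg ng; apply NNPP; intros K; apply ng, coord_ext; auto.
  intros b; rewrite coord_one; apply NNPP; intros C; eauto.
Qed.

Lemma coord_basis b h : H h -> coord b h <> 0%Z -> B b.
Proof.
  intros Hh C; apply coef_in, in_map_iff in C as (p & <- & inp).
  exact (proj1 (Forall_forall _ _) (proj1 (rep_spec Hh)) p inp).
Qed.

Lemma basis_character g : H g -> g <> one ->
  exists c : G -> Z, (forall x, H x -> c (g ** x) = c g + c x)%Z /\ c g <> 0%Z.
Proof.
  intros Hg ng; destruct (coord_nontrivial Hg ng) as [b Cb]; exists (coord b); split; auto.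
  intros x Hx; apply coordM; auto.
Qed.

(** * Independent families of endomorphisms *)

Definition pow2 (n : nat) : G -> G := Nat.iter n (fun x => x ** x).

Lemma pow2_mem n x : H x -> H (pow2 n x).
Proof. intros Hx; induction n as [|n IH]; [exact Hx|apply HM; exact IH]. Qed.

Lemma coord_pow2 b n x : H x -> coord b (pow2 n x) = (2 ^ Z.of_nat n * coord b x)%Z.
Proof.
  intros Hx; induction n as [|n IH]; [symmetry; apply Z.mul_1_l|].
  change (pow2 (S n) x) with (pow2 n x ** pow2 n x).
  rewrite coordM, IH, Nat2Z.inj_succ, Z.pow_succ_r; auto using pow2_mem; lia.
Qed.

(** Let g have a nonzero coordinate of absolute value k. If i and j were both at least k, then 2^k
    would divide this coordinate, although 2^k > k. *)
Lemma pow2_independent : independent_endos mul one H pow2.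
Proof.
  split.
  - intros n; split; [intros x; apply pow2_mem|split].
    + intros x y Hx Hy; apply coord_ext; auto using pow2_mem.
      intros b; rewrite coordM, !coord_pow2, coordM; auto using pow2_mem; lia.
    + intros x y Hx Hy E; apply coord_ext; auto. intros b.
      assert (C : coord b (pow2 n x) = coord b (pow2 n y)) by congruence.
      rewrite !coord_pow2 in C; auto.
      assert (0 < 2 ^ Z.of_nat n)%Z by (apply Z.pow_pos_nonneg; lia). nia.
  - intros g Hg ng; destruct (coord_nontrivial Hg ng) as [b Cb].
    set (k := Z.abs_nat (coord b g)).
    exists (seq 0 k); intros i j u v Hu Hv E.
    rewrite !in_seq; apply NNPP; intros K.
    assert (C : coord b (pow2 i u) = coord b (g ** pow2 j v)) by congruence.
    rewrite coordM, !coord_pow2 in C; auto using pow2_mem.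
    assert (D : forall n z, k <= n -> (2 ^ Z.of_nat k | 2 ^ Z.of_nat n * z)%Z).
    { intros n z L. exists (2 ^ Z.of_nat (n - k) * z)%Z.
      replace (Z.of_nat n) with (Z.of_nat (n - k) + Z.of_nat k)%Z by lia.
      rewrite Z.pow_add_r by lia; lia. }
    assert (Dg : (2 ^ Z.of_nat k | coord b g)%Z).
    { replace (coord b g) with
        (2 ^ Z.of_nat i * coord b u - 2 ^ Z.of_nat j * coord b v)%Z by lia.
      apply Z.divide_sub_r; apply D; lia. }
    apply Z.divide_abs_r, Z.divide_pos_le in Dg; [|lia].
    pose proof (Z.pow_gt_lin_r 2 (Z.of_nat k)). lia.
Qed.

Section Reindexing.
Variables (I : Type) (p : I -> G -> G).
Hypothesis pB : forall i b, B b -> B (p i b).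
Hypothesis pinj : forall i j b b', B b -> B b' -> p i b = p j b' -> i = j /\ b = b'.

Definition push (i : I) (l : list (G * Z)) := map (fun q => (p i (fst q), snd q)) l.
(** The endomorphism of H induced by the injection [p i] of the basis. As [rep] is a mere choice,
    its additivity is checked on coordinates. *)
Definition reindex (i : I) (h : G) : G := zcomb (push i (rep h)).

Lemma push_over i l : over_B l -> over_B (push i l).
Proof.
  intros Bl; apply Forall_map; eapply Forall_impl; [|exact Bl]; intros q Bq; apply pB; exact Bq.
Qed.

Lemma reindex_mem i h : H h -> H (reindex i h).
Proof. intros Hh; apply zcomb_mem, push_over, rep_spec, Hh. Qed.

Lemma coef_push i b l : B b -> over_B l -> coef (p i b) (push i l) = coef b l.
Proof.
  intros Bb; induction 1 as [|q l Bq _ IH]; simpl; [reflexivity|]. rewrite IH.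
  destruct (excluded_middle_informative (fst q = b)) as [E|E];
    destruct (excluded_middle_informative (p i (fst q) = p i b)) as [E'|E']; auto.
  - exfalso; apply E'; congruence.
  - exfalso; apply E; apply (pinj (i := i) (j := i)); auto.
Qed.

Lemma coord_reindex i b h : B b -> H h -> coord (p i b) (reindex i h) = coord b h.
Proof.
  intros Bb Hh; unfold reindex; rewrite coord_zcomb; [|apply push_over, rep_spec, Hh].
  apply coef_push; auto; apply rep_spec, Hh.
Qed.

Lemma coord_reindex_support i b' h : H h -> coord b' (reindex i h) <> 0%Z ->
  exists b, B b /\ b' = p i b.
Proof.
  intros Hh; unfold reindex; rewrite coord_zcomb; [|apply push_over, rep_spec, Hh].
  intros C; apply coef_in in C. unfold push in C; rewrite map_map in C.
  apply in_map_iff in C as (q & <- & inq); exists (fst q); split; auto.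
  exact (proj1 (Forall_forall _ _) (proj1 (rep_spec Hh)) q inq).
Qed.

(** The ranges of the maps [p i] on B are pairwise disjoint, so each entry of [L] contributes at
    most one index. *)
Lemma finite_indices (L : list G) :
  exists l : list I, forall b' i b, In b' L -> B b -> b' = p i b -> In i l.
Proof.
  induction L as [|c L [l Hl]]; [exists nil; intros b' i b []|].
  destruct (classic (exists i b, B b /\ c = p i b)) as [(i0 & b0 & Bb0 & E0)|none].
  - exists (i0 :: l); intros b' i b [<-|inb] Bb E; [left|right; eauto].
    apply (pinj (b := b0) (b' := b)); congruence.
  - exists l; intros b' i b [<-|inb] Bb E; [exfalso; eauto|eauto].
Qed.

(** Fix b with a nonzero coordinate in g. An equation between a value of the i-th map and the
    g-shift of a value of the j-th forces one of these values to have b in its support, so b is in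
    the range of [p i] or [p j]. Finitely many indices qualify. *)
Lemma reindex_independent : independent_endos mul one H reindex.
Proof.
  split.
  - intros i; split; [intros x; apply reindex_mem|split].
    + intros x y Hx Hy; apply coord_ext; auto using reindex_mem.
      intros b'; rewrite coordM; auto using reindex_mem.
      destruct (classic (exists b, B b /\ b' = p i b)) as [(b & Bb & ->)|none].
      * rewrite !coord_reindex; auto; apply coordM; auto.
      * assert (Z0 : forall h, H h -> coord b' (reindex i h) = 0%Z).
        { intros h Hh; apply NNPP; intros C; apply none, (coord_reindex_support i _ Hh C). }
        rewrite !Z0; auto.
    + intros x y Hx Hy E; apply coord_ext; auto. intros b.
      destruct (classic (B b)) as [Bb|nB].
      * rewrite <- (coord_reindex i Bb Hx), <- (coord_reindex i Bb Hy), E; reflexivity.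
      * assert (Z0 : forall h, H h -> coord b h = 0%Z).
        { intros h Hh; apply NNPP; intros C; apply nB, (coord_basis _ Hh C). }
        rewrite !Z0; auto.
  - intros g Hg ng. destruct (finite_indices (map fst (rep g))) as [l Hl].
    exists l; intros i j u v Hu Hv E.
    destruct (coord_nontrivial Hg ng) as [b Cb].
    pose proof (coef_in _ _ Cb) as inb.
    assert (C : coord b (reindex i u) = coord b (g ** reindex j v)) by congruence.
    rewrite coordM in C; auto using reindex_mem.
    destruct (Z.eq_dec (coord b (reindex i u)) 0) as [Ci|Ci].
    + assert (Cj : coord b (reindex j v) <> 0%Z) by lia.
      destruct (coord_reindex_support j _ Hv Cj) as (b0 & Bb0 & E0); right; eauto.
    + destruct (coord_reindex_support i _ Hu Ci) as (b0 & Bb0 & E0); left; eauto.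
Qed.

End Reindexing.

Lemma card_le_free_abelian : card_le {x | H x} (list ({b | B b} * Z)).
Proof.
  pose (ev := fun l : list ({b | B b} * Z) => map (fun q => (proj1_sig (fst q), snd q)) l).
  assert (evB : forall l, over_B (ev l)).
  { intros l; apply Forall_map, Forall_forall; intros [[b Bb] z] _; exact Bb. }
  apply (card_le_surj (fun l => exist H (zcomb (ev l)) (zcomb_mem (evB l)))).
  intros [h Hh]; destruct (Bspan Hh) as (l & Bl & ->).
  assert (lift : exists l', ev l' = l).
  { clear Hh; induction Bl as [|[b z] l Bb _ [l' <-]]; [exists nil; reflexivity|].
    exists ((exist _ b Bb, z) :: l'); reflexivity. }
  destruct lift as [l' <-]; exists l'.
  apply eq_sig_hprop; [intros; apply proof_irrelevance|reflexivity].
Qed.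

(* Powers of 2 serve for a countable basis; an infinite basis B splits into |B| = |H| copies of
   itself. *)
Lemma independent_endos_exist (W : Type) : card_le W {x | H x} ->
  exists (I : Type) (phi : I -> G -> G) (e : W -> I),
    independent_endos mul one H phi /\ forall a b, e a = e b -> a = b.
Proof.
  intros WH; pose proof (card_le_trans WH card_le_free_abelian) as Wlist.
  destruct (card_le_total nat {b | B b}) as [inf|fin].
  - assert (WB : card_le W {b | B b}).
    { apply (card_le_trans Wlist), card_le_list_Z; [exact inf|exists (fun x => x); auto]. }
    assert (sq : card_le (W * {b | B b}) {b | B b}).
    { apply card_le_trans with ({b | B b} * {b | B b})%type; [|apply card_le_square; exact inf].
      apply card_le_prod; [exact WB|exists (fun x => x); auto]. }
    destruct sq as [f finj].
    pose (p := fun w b => match excluded_middle_informative (B b) with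
                          | left Bb => proj1_sig (f (w, exist _ b Bb)) | right _ => b end).
    assert (pE : forall w b (Bb : B b), p w b = proj1_sig (f (w, exist _ b Bb))).
    { intros w b Bb; unfold p; destruct (excluded_middle_informative (B b)) as [Bb'|]; [|tauto].
      rewrite (proof_irrelevance _ Bb' Bb); reflexivity. }
    exists W, (reindex p), (fun w => w); split; auto.
    apply reindex_independent.
    + intros w b Bb; rewrite (pE w b Bb); exact (proj2_sig (f _)).
    + intros w w' b b' Bb Bb'; rewrite (pE w b Bb), (pE w' b' Bb'); intros E.
      assert (E' : f (w, exist _ b Bb) = f (w', exist _ b' Bb')).
      { apply eq_sig_hprop; [intros; apply proof_irrelevance|exact E]. }
      apply finj in E'; injection E'; auto.
  (* Here B embeds in [nat], hence so does W, and natural numbers suffice as indices. *)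
  - destruct (card_le_trans Wlist (card_le_list_Z (Y := nat)
      (ex_intro _ (fun n => n) (fun a b E => E)) fin)) as [e einj].
    exists nat, pow2, e; split; [exact pow2_independent|exact einj].
Qed.

End Basis.


(** For infinite G, an ordinal α < |G|⁺ is the position of the top element in the well-order α + 1,
    whose size is at most |G|; this is the role of [W] and [t]. *)
Theorem theorem6p1
  (G : Type) (mul : G -> G -> G) (one : G) (inv : G -> G)
  (HG : is_group mul one inv)
  (Ginf : card_le nat G)
  (H : G -> Prop) (HH : free_abelian_subgroup mul one inv H)
  (Hcard : equipotent {x : G | H x} G)
  (F : (G -> Prop) -> Prop) (Fid : is_ideal F) (Fsub : sub_invariant mul one inv F)
  (Fnot : exists A, tau mul F A /\ subset A H /\ ~ F A) :
  forall (W : Type) (lt : W -> W -> Prop), well_order lt ->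
  card_le W G ->
  forall t : W,
    ~ fam_eq (tau_star mul F) (tau_iter mul F lt t) /\
    ~ fam_eq (tau_iter mul F lt t) (tau_below mul F lt t).
Proof.
  intros W lt WO WG t.
  destruct HH as (Hsub & Hcomm & B & BH & Bspan & Bfree).
  destruct Fsub as [Finv Fiso]. destruct Fnot as (A0 & tA0 & A0H & nA0).
  destruct Hcard as (f & _ & fsur).
  pose proof (card_le_surj f fsur) as GH.
  assert (nontriv : exists x0, H x0 /\ x0 <> one).
  { destruct (card_le_trans Ginf GH) as [nu nuinj].
    destruct (classic (proj1_sig (nu 0) = one)) as [E0|n0].
    - exists (proj1_sig (nu 1)); split; [exact (proj2_sig (nu 1))|]. intros E1.
      assert (E : nu 0 = nu 1).
      { apply eq_sig_hprop; [intros; apply proof_irrelevance|congruence]. }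
      apply nuinj in E; discriminate.
    - exists (proj1_sig (nu 0)); split; [exact (proj2_sig (nu 0))|exact n0]. }
  destruct nontriv as (x0 & Hx0 & nx0).
  (* The empty set is a subset of [x0]A0 ∩ A0, which is in F because [A0] is in [tau mul F]. *)
  assert (Fempty : F (fun _ => False)).
  { apply (proj1 Fid _ _ (fun g K => False_ind _ K) (tA0 x0 one nx0)). }
  pose proof (basis_character HG Hsub Hcomm _ BH Bspan Bfree) as Hchar.
  destruct (independent_endos_exist HG Hsub Hcomm _ BH Bspan Bfree (card_le_trans WG GH))
    as (I & phi & e & indep & einj).
  destruct (thin_not_tau_iter HG Hsub Hcomm Hchar Fid Finv Fempty Fiso WO e indep einj
    A0H (thin_tau HG H Fid tA0) nA0 Hx0 nx0 t) as (A & AH & tA & nA).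
  pose proof (fun X FX fixX => thin_in_fixpoint HG Hsub Fid Fempty (X := X) FX fixX AH tA) as inX.
  split; intros E.
  - apply nA, (proj1 (E A)). intros X FX fixX; exact (inX X FX fixX).
  (* For t not least, equality would make [tau_below] at t a fixed point of [tau] above F, hence one
     containing the thin set [A]. For t least, [tau_below] has no members, whereas level 0 contains
     the empty set. *)
  - destruct (classic (exists s, lt s t)) as [[s st]|least].
    + apply nA, (proj2 (E A)), inX.
      * intros C FC; exists s; split; [exact st|]. apply (base_tau_iter Fid Finv WO s _ FC).
      * intros C; split.
        -- intros tC; apply E, ti_succ; [exists s; exact st|exact tC].
        -- intros bC; apply E in bC.
           destruct bC as [t C least _|t C _ tC]; [exfalso; exact (least s st)|exact tC].
    + destruct (proj1 (E (fun _ => False))) as (s & st & _); [|eauto].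
      apply base_tau_iter; assumption.
Qed.
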